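(* Let $\lambda=(\lambda_1,\dots,\lambda_l)$ be a partition of length $l$ and $\tau(t)=s_\lambda(t)+\sum_{\lambda<\mu}\xi_\mu s_\mu(t)$ with $\xi_\mu\in\mathbb C$. (i) If $m<N'_{\lambda,1}$ then $\partial_1^m\tau([x_1]-[x_2])=0$. (ii) $\partial_1^{N'_{\lambda,1}}\tau([x_1]-[x_2])=c_\lambda\,\tau_2([x_1]-[x_2])$. (iii) $\tau_2([x_1]-[x_2])=(-1)^{l-1}x_1^{\lambda_1-1}x_2^{l-1}(x_1-x_2)(1+\cdots)$, where $\cdots$ is a series in $x_1,x_2$ containing only monomials $x_1^ix_2^j$ with $i+j>0$. (iv) $\tau_2([x_1]-[x_2])=(-1)^{l-1}\tau^{(1)}([x_1])x_2^{l-1}+O(x_2^l)$.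
   Context: For $t=(t_1,t_2,\dots)$ define $p_m(t)$ by $\exp(\sum_{m\ge1}t_mk^m)=\sum_{m\ge0}p_m(t)k^m$, $p_m=0$ for $m<0$; $s_\mu(t)=\det(p_{\mu_i-i+j}(t))_{1\le i,j\le l}$. $[x]=(x,x^2/2,\dots)$, $\partial_1=\partial/\partial t_1$. $\lambda<\mu$ means $\lambda_i\le\mu_i$ for all $i$ and $\lambda\ne\mu$. $\tau$ is a formal series, differentiated termwise, evaluations being formal power series. $(w_l,\dots,w_1)=(\lambda_1,\dots,\lambda_l)+(l-1,\dots,1,0)$; $N'_{\lambda,1}=\sum_{i=2}^l\lambda_i-l+1$; $c_\lambda=\frac{N'_{\lambda,1}!}{\prod_{i=1}^{l-1}(w_i-1)!}\prod_{1\le i<j\le l-1}(w_j-w_i)$. $\tau_2(t)=s_{(\lambda_1,1^{l-1})}(t)+\sum_\mu\xi_\mu s_{(\mu_1,1^{l'-1})}(t)$, summed over partitions $\mu=(\mu_1,\dots,\mu_{l'})$ of length $l'\ge l$ with $\lambda<\mu$, $\mu_i=\lambda_i$ for $2\le i\le l$, $\mu_i=1$ for $i>l$ ($(a,1^{r})$ denotes $(a,1,\dots,1)$ with $r$ ones). $\tau^{(1)}(t)=s_{(\lambda_1)}(t)+\sum_\mu\xi_\mu s_{(\mu_1)}(t)$ summed over $\mu=(\mu_1,\dots,\mu_l)$ with $\lambda<\mu$ and $\mu_i=\lambda_i$ for $2\le i\le l$. *)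

(* Defs.v *)
From HB Require Import structures.
From mathcomp Require Import all_boot all_order all_algebra.
From mathcomp Require Import reals complex.
From mathcomp Require Import mpoly.
Set Implicit Arguments. Unset Strict Implicit. Unset Printing Implicit Defensive.
Import Order.TTheory GRing.Theory Num.Theory.
Local Open Scope ring_scope.

Definition is_partition (s : seq nat) : bool :=
  sorted (fun a b => (b <= a)%N) s && all (fun x => (0 < x)%N) s.

Definition ptn_lt (lam mu : seq nat) : bool :=
  all (fun i => (nth 0 lam i <= nth 0 mu i)%N) (iota 0 (size lam)) && (lam != mu).

(* Finite codes for the partitions of size <= D: weakly decreasing
   functions 'I_D -> 'I_D.+1 with total <= D (zeros = padding).
   Each partition of size <= D has exactly one code. *)
Definition ptn_code (D : nat) (f : {ffun 'I_D -> 'I_D.+1}) : bool :=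
  [forall i : 'I_D, forall j : 'I_D, (i <= j)%N ==> (f j <= f i)%N]
  && (\sum_(i < D) (f i : nat) <= D)%N.

Definition ptn_of (D : nat) (f : {ffun 'I_D -> 'I_D.+1}) : seq nat :=
  filter (fun x => (0 < x)%N) [seq (f i : nat) | i <- enum 'I_D].

Section Schur.
Variable C : fieldType.

Definition tvar (n k : nat) : {mpoly C[n]} :=
  match k with
  | 0 => 0
  | k'.+1 => match insub k' with Some o => 'X_o | None => 0 end
  end.

(* p_m(t) : coefficient of k^m in exp(sum_{i>=1} t_i k^i); the exponential
   series and the inner sum are truncated at order m, which does not affect
   the coefficient of k^m. *)
Definition pfun (n m : nat) : {mpoly C[n]} :=
  let g : {poly {mpoly C[n]}} := \sum_(1 <= i < m.+1) tvar n i *: 'X^i in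
  \sum_(r < m.+1) ((r`!)%:R)^-1 *: (g ^+ r)`_m.

Definition pfunz (n : nat) (z : int) : {mpoly C[n]} :=
  match z with Posz m => pfun n m | Negz _ => 0 end.

Definition schur (n : nat) (mu : seq nat) : {mpoly C[n]} :=
  \det (\matrix_(i < size mu, j < size mu)
          pfunz n ((nth 0 mu i)%:Z - i%:Z + j%:Z)).

(* Number of variables used for s_mu: all p_r occurring have
   r <= mu_1 + l - 1, so t_1, ..., t_{mu_1 + l} suffice. *)
Definition nvar (mu : seq nat) : nat := (head 0%N mu + size mu).+1.

Definition fps := nat -> nat -> C.

(* (partial_1^m s_mu)(t) evaluated at t_k = pt k (k >= 1), where pt k is a
   polynomial in x1 (outer variable) and x2 (inner variable). *)
Definition dschur_ev (pt : nat -> {poly {poly C}}) (m : nat) (mu : seq nat)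
  : {poly {poly C}} :=
  mmap (fun c : C => c%:P%:P) (fun k : 'I_(nvar mu) => pt k.+1)
       (iter m (mderiv ord0) (schur (nvar mu) mu)).

(* The formal series (partial_1^m sum_mu b(mu) s_mu)(pt) : coefficient of
   x1^i x2^j.  Since s_mu(t) is homogeneous of weight |mu|, and the t_k are
   evaluated at series of order k, only partitions with |mu| = i+j+m
   contribute to this coefficient; we sum over all partitions of size
   <= i + j + m (the others contribute 0). *)
Definition tau_ev (b : seq nat -> C) (m : nat) (pt : nat -> {poly {poly C}})
  : fps := fun i j =>
  let D := (i + j + m)%N in
  \sum_(f : {ffun 'I_D -> 'I_D.+1} | ptn_code f)
     b (ptn_of f) * ((dschur_ev pt m (ptn_of f))`_i)`_j.

Definition pt_x1x2 (k : nat) : {poly {poly C}} :=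
  ((k%:R)^-1)%:P%:P * ('X^k - ('X^k)%:P).
Definition pt_x1 (k : nat) : {poly {poly C}} :=
  ((k%:R)^-1)%:P%:P * 'X^k.

Definition tau_coef (lam : seq nat) (xi : seq nat -> C) (mu : seq nat) : C :=
  if mu == lam then 1 else if ptn_lt lam mu then xi mu else 0.

(* tau_2 = s_(lambda_1,1^(l-1)) + sum_mu xi_mu s_(mu_1,1^(l'-1)), over mu
   with l' >= l, lambda < mu, mu_i = lambda_i (2<=i<=l), mu_i = 1 (i > l).
   Coefficient of the hook nu = (a, 1^r): the unique such mu (or lambda)
   with nu = (mu_1, 1^(l'-1)) is mu = (a, lambda_2..lambda_l, 1^(r-(l-1))),
   required r >= l-1. *)
Definition tau2_coef (lam : seq nat) (xi : seq nat -> C) (nu : seq nat) : C :=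
  match nu with
  | [::] => 0
  | a :: rest =>
      if (rest == nseq (size rest) 1%N) && ((size lam).-1 <= size rest)%N
      then tau_coef lam xi (a :: behead lam ++ nseq (size rest - (size lam).-1) 1%N)
      else 0
  end.

(* tau^(1) = s_(lambda_1) + sum_mu xi_mu s_(mu_1), over mu = (mu_1..mu_l)
   with lambda < mu and mu_i = lambda_i for 2 <= i <= l. *)
Definition tau1_coef (lam : seq nat) (xi : seq nat -> C) (nu : seq nat) : C :=
  match nu with
  | [:: a] => tau_coef lam xi (a :: behead lam)
  | _ => 0
  end.

Definition Nprime (lam : seq nat) : nat :=
  ((\sum_(1 <= i < size lam) nth 0 lam i) - (size lam).-1)%N.

Definition wseq (lam : seq nat) (i : nat) : nat :=
  (nth 0 lam (size lam - i) + i - 1)%N.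

Definition c_lam (lam : seq nat) : C :=
  let l := size lam in
  ((Nprime lam)`!)%:R / (\prod_(1 <= i < l) (((wseq lam i).-1)`!)%:R)
  * \prod_(1 <= i < l) \prod_(i.+1 <= j < l)
        ((wseq lam j)%:R - (wseq lam i)%:R).

Definition fps_add (F G : fps) : fps := fun i j => F i j + G i j.
Definition fps_mul (F G : fps) : fps := fun i j =>
  \sum_(a < i.+1) \sum_(b < j.+1) F a b * G (i - a)%N (j - b)%N.
Definition fps_scale (c : C) (F : fps) : fps := fun i j => c * F i j.
Definition fps_mono (a b : nat) : fps := fun i j =>
  if (i == a) && (j == b) then 1 else 0.

End Schur.

(* Main.v *)
Require Import Defs.
From HB Require Import structures.
From mathcomp Require Import all_boot all_order all_algebra.
From mathcomp Require Import perm reals complex.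
From mathcomp Require Import mpoly ring lra zify.
Import Order.TTheory GRing.Theory Num.Theory.
Set Implicit Arguments. Unset Strict Implicit. Unset Printing Implicit Defensive.
Local Open Scope ring_scope.

(** By Taylor's formula, [d_1^m s_mu ([x1] - [x2])] is [m!] times the
    coefficient of [y^m] in [s_mu ([x1] - [x2] + (y, 0, 0, ..))], a
    Jacobi-Trudi determinant in the coefficients of
    [e^(yz) (1 - x2 z) / (1 - x1 z)].  Subtracting from every column [x1] times
    its left neighbour leaves the coefficients of [e^(yz) (1 - x2 z)] in all
    columns but the first, and these are explicit binomials in [y].  With the
    weights [mu_i - i] for row [i], [-mu_0] for column [0] and [j - 1] for
    column [j] the lowest-order terms in [y] of the entries are homogeneous, so
    the determinant starts in degree [N'_mu], with coefficient
    [x1^(mu_0 - 1) (x1 - x2) (- x2)^(l(mu) - 1) det (1 / (mu_i - 1 - i + j)!)].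
    If [mu] dominates [lambda] then [N'_lambda <= N'_mu], with equality exactly
    when [mu] and [lambda] differ only in the first row and in rows of length
    one at the bottom; these [mu] yield the hooks of [tau_2].  A falling
    factorial Vandermonde determinant gives [c_lambda]. *)

(** * Newton's recursion for the polynomials p_m *)

Section PowerCoefficients.
Variable R : comNzRingType.
Implicit Types g h : {poly R}.

Lemma coef_exp_low g r k : g`_0 = 0 -> (k < r)%N -> (g ^+ r)`_k = 0.
Proof.
move=> g0; elim: r k => // r IHr k kr.
rewrite exprS coefM big_ord_recl g0 mul0r add0r big1 // => i _ /=.
by rewrite IHr ?mulr0 // /bump; have := ltn_ord i; lia.
Qed.

Lemma coef_exp_eq g h m r :
  (forall k, (k <= m)%N -> g`_k = h`_k) ->
  forall k, (k <= m)%N -> (g ^+ r)`_k = (h ^+ r)`_k.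
Proof.
move=> eq_gh; elim: r => [|r IHr] k km; first by rewrite !expr0.
rewrite !exprS !coefM; apply: eq_bigr => i _.
by rewrite eq_gh ?IHr //; have := ltn_ord i; lia.
Qed.

End PowerCoefficients.

Section Newton.
Variables (C : numFieldType) (n : nat).

Let gser N : {poly {mpoly C[n]}} := \sum_(1 <= i < N.+1) tvar C n i *: 'X^i.

Lemma coef_gser N k : (gser N)`_k = if (k <= N)%N then tvar C n k else 0.
Proof.
have -> : gser N = \poly_(i < N.+1) tvar C n i.
  by rewrite poly_def /gser big_add1 /= big_mkord big_ord_recl /= scale0r add0r.
by rewrite coef_poly.
Qed.

(** [pfun] truncates both series at an order depending on m. A recursion in m needs one common
    truncation, and the extra terms do not reach degree m because the inner series has no constant
    term. *)
Lemma pfun_trunc N K m : (m <= N)%N -> (m <= K)%N ->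
  pfun C n m = \sum_(r < K.+1) ((r`!)%:R)^-1 *: (gser N ^+ r)`_m.
Proof.
move=> mN mK.
rewrite /pfun -/(gser m).
rewrite (big_ord_widen K.+1 (fun r => ((r`!)%:R)^-1 *: (gser m ^+ r)`_m)) //.
rewrite big_mkcond; apply: eq_bigr => r _; case: ifP => rm.
  congr (_ *: _); apply: coef_exp_eq (leqnn m) => k km.
  by rewrite !coef_gser km (leq_trans km mN).
by rewrite coef_exp_low ?scaler0 ?coef_gser //; lia.
Qed.

(** This is the coefficient of z^m in (exp g)' = g' exp g. Differentiation turns g^(r+1)/(r+1)! into
    g' g^r/r!, so the exponential is cut one order lower on the right. *)
Lemma pfun_newton m :
  m.+1%:R * pfun C n m.+1 =
    \sum_(k < m.+1) k.+1%:R * tvar C n k.+1 * pfun C n (m - k).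
Proof.
rewrite (@pfun_trunc m.+1 m.+1) //.
under [RHS]eq_bigr => k _.
  rewrite (@pfun_trunc m.+1 m) ?mulr_sumr; try lia.
  over.
rewrite exchange_big /= big_ord_recl mulrDr.
rewrite expr0 coef1 /= scaler0 mulr0 add0r mulr_sumr.
apply: eq_bigr => r _.
rewrite /bump /= add1n -scalerAr.
have -> : m.+1%:R * (gser m.+1 ^+ r.+1)`_m.+1 = ((gser m.+1 ^+ r.+1)^`())`_m.
  by rewrite coef_deriv mulr_natl.
rewrite deriv_exp coefMn coefM /= factS natrM invfM -scaler_nat.
rewrite scalerA mulrAC mulVf ?mul1r ?pnatr_eq0 // scaler_sumr.
apply: eq_bigr => k _.
rewrite coef_deriv coef_gser ifT -?scalerAr; last by have := ltn_ord k; lia.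
by rewrite mulr_natl.
Qed.

End Newton.

(** * The values of p_m at [x1] - [x2] + (y, 0, 0, ..) *)

Section Evaluation.
Variables (C : numFieldType) (S : comNzRingType) (iota : {rmorphism C -> S}).
Variables (x1 x2 y : S).

(** Coefficients of e^(yz), extended by 0 because Jacobi-Trudi indices may be negative. *)
Definition exp_coef (z : int) : S :=
  if z is Posz m then iota (m`!%:R^-1) * y ^+ m else 0.

Lemma exp_coefS m : m.+1%:R * exp_coef m.+1 = y * exp_coef m.
Proof.
rewrite /exp_coef factS natrM invfM rmorphM exprS -(rmorph_nat iota).
rewrite !mulrA -rmorphM /= mulfV ?pnatr_eq0 // rmorph1 mul1r; ring.
Qed.

(** [S] is only a commutative ring, but [iota] supplies the inverses of positive integers. *)
Lemma nat_mulI m (a b : S) : m.+1%:R * a = m.+1%:R * b -> a = b.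
Proof.
move=> /(congr1 (fun c => iota (m.+1%:R^-1) * c)).
by rewrite !mulrA -(rmorph_nat iota) -rmorphM /= mulVf ?pnatr_eq0 // rmorph1
  !mul1r.
Qed.

(* Generating functions e^(yz)/(1 - x1 z) and x1 e^(yz)/(1 - x1 z)^2. *)
Fixpoint egeom m : S :=
  if m is m'.+1 then x1 * egeom m' + exp_coef m else 1.
Fixpoint egeom2 m : S :=
  if m is m'.+1 then x1 * egeom m + x1 * egeom2 m' else x1.

Lemma exp_coef0 : exp_coef 0 = 1.
Proof. by rewrite /exp_coef /= invr1 rmorph1 expr0 mul1r. Qed.

(** Coefficientwise product rule for the derivative of e^(yz) / (1 - x1 z). *)
Lemma egeom_deriv m : m.+1%:R * egeom m.+1 = y * egeom m + egeom2 m.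
Proof.
elim: m => [|m IHm].
  rewrite [egeom 1]/= !mulrDr exp_coefS exp_coef0 /=; ring.
rewrite [egeom m.+2]/= -/(egeom m.+1) mulrDr exp_coefS /=.
rewrite [_ * (x1 * _)]mulrCA -natr1 mulrDl IHm /=; ring.
Qed.

(** The recursion says Q' = (x1/(1 - x1 z) - x2/(1 - x2 z) + y) Q, whose solution with Q(0) = 1 is
    e^(yz) (1 - x2 z)/(1 - x1 z). The conclusion is this formula multiplied by 1 - x1 z. *)
Lemma newton_unique n (q : nat -> S) :
  q 0%N = 1 ->
  (forall m, (m < n)%N -> m.+1%:R * q m.+1 =
     \sum_(k < m.+1) (x1 ^+ k.+1 - x2 ^+ k.+1 + (if k == 0 :> nat then y else
       0))
                       * q (m - k)%N) ->
  forall m, (m < n)%N ->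
    q m.+1 = x1 * q m + exp_coef m.+1 - x2 * exp_coef m.
Proof.
move=> q0 qS.
pose A x m := \sum_(k < m.+1) x ^+ k.+1 * q (m - k)%N.
have AS x m : A x m.+1 = x * q m.+1 + x * A x m.
  rewrite /A big_ord_recl expr1 subn0; congr (_ + _).
  by rewrite mulr_sumr; apply: eq_bigr => k _; rewrite mulrA -exprS.
have A0 x : A x 0%N = x by rewrite /A big_ord1 q0 mulr1.
have qA m : (m < n)%N -> m.+1%:R * q m.+1 = A x1 m - A x2 m + y * q m.
  move=> mn; rewrite qS // /A -sumrB.
  under eq_bigr => k _ do rewrite mulrDl mulrBl.
  rewrite big_split /=; congr (_ + _).
  by rewrite big_ord_recl /= subn0 big1 ?addr0 // => k _; rewrite mul0r.
(* [A x] lists the coefficients of x Q/(1 - x z). Carrying both sums along makes each induction step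
   depend only on the previous one. *)
have main m : (m < n)%N -> [/\ q m.+1 = egeom m.+1 - x2 * egeom m,
    A x1 m.+1 = egeom2 m.+1 - x2 * egeom2 m & A x2 m.+1 = x2 * egeom m.+1].
  elim: m => [|m IHm] mn.
    have q1 : q 1%N = egeom 1 - x2 * egeom 0.
      apply: (@nat_mulI 0); rewrite qA // !A0 q0 mulrBr egeom_deriv /=; ring.
    by rewrite !AS !A0 q1 /=; split=> //; ring.
  have [qm A1 A2] := IHm (ltnW mn).
  have qm2 : q m.+2 = egeom m.+2 - x2 * egeom m.+1.
    apply: (@nat_mulI m.+1); rewrite qA // A1 A2 qm [RHS]mulrBr egeom_deriv.
    by rewrite [_ * (x2 * _)]mulrCA -[X in x2 * (X * _)]natr1 mulrDl
      egeom_deriv; ring.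
  by rewrite !(AS _ m.+1) qm2 A1 A2; split=> //; rewrite /=; ring.
case=> [|m] mn.
  have [-> _ _] := main _ mn.
  by rewrite q0 exp_coef0 /=; ring.
have [-> _ _] := main _ mn; have [-> _ _] := main _ (ltnW mn).
by rewrite /=; ring.
Qed.

Variable n : nat.
Variable h : 'I_n -> S.
Hypothesis hE : forall k : 'I_n, h k =
  iota (k.+1%:R^-1) * (x1 ^+ k.+1 - x2 ^+ k.+1) + (if k == 0 :> nat then y else
    0).

Lemma mmap_pfun_rec m : (m < n)%N ->
  mmap iota h (pfun C n m.+1) =
    x1 * mmap iota h (pfun C n m) + exp_coef m.+1 - x2 * exp_coef m.
Proof.
apply: (@newton_unique n (fun m => mmap iota h (pfun C n m))) => [|{}m mn].
  by rewrite /pfun big_ord1 expr0 coef1 invr1 scale1r rmorph1.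
have := pfun_newton C n m => /(congr1 (mmap iota h)).
rewrite rmorphM rmorph_nat => ->; rewrite rmorph_sum; apply: eq_bigr => k _.
rewrite !rmorphM rmorph_nat; congr (_ * _) => /=.
case: insubP => [o _ ok|]; last by rewrite ltnNge; have := ltn_ord k; lia.
rewrite mmapX mmap1U hE ok mulrDr mulrA -(rmorph_nat iota) -rmorphM /=.
rewrite mulfV ?pnatr_eq0 // rmorph1 mul1r; congr (_ + _).
by case: (nat_of_ord k) => [|j] /=; rewrite ?mulr0 ?rmorph1 ?mul1r.
Qed.

Lemma mmap_pfunz_rec z : z <= n%:Z ->
  mmap iota h (pfunz C n z) =
    x1 * mmap iota h (pfunz C n (z - 1)) + exp_coef z - x2 * exp_coef (z - 1).
Proof.
case: z => [[|m]|m] zn.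
- by rewrite exp_coef0 /= raddf0 !mulr0 subr0 add0r /pfun big_ord1 expr0 coef1
  invr1 scale1r rmorph1.
- by have -> : Posz m.+1 - 1 = m :> int; [lia | rewrite mmap_pfun_rec].
- by rewrite (_ : Negz m - 1 = Negz m.+1) /= ?raddf0; [ring|lia].
Qed.

End Evaluation.

(** * Lowest-order terms of products and determinants *)

Section LowestTerm.
Variable R : comNzRingType.

(* [p] is divisible by [X^d] with coefficient [c] at [X^d]; for negative [d]
   the only constraint is [c = 0]. *)
Definition low_term (d : int) (c : R) (p : {poly R}) : Prop :=
  (forall m : nat, m%:Z <= d -> p`_m = if m%:Z == d then c else 0)
  /\ (d < 0 -> c = 0).

Lemma low_term0 d : low_term d 0 0.
Proof. by split=> // m _; rewrite coef0 if_same. Qed.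

Lemma low_term_coef0 (p : {poly R}) : low_term 0 p`_0 p.
Proof. by split=> // -[|m]. Qed.

Lemma low_term_neg d p : d < 0 -> low_term d 0 p.
Proof. by move=> d0; split=> // m md; lia. Qed.

Lemma low_term_pred d c p : low_term d c p -> low_term (d - 1) 0 p.
Proof.
case=> H _; split=> // m md; rewrite if_same H; last by lia.
by case: eqP => // ?; lia.
Qed.

Lemma low_termD d c1 c2 p1 p2 :
  low_term d c1 p1 -> low_term d c2 p2 -> low_term d (c1 + c2) (p1 + p2).
Proof.
move=> [H1 N1] [H2 N2]; split=> [m md|d0]; last by rewrite N1 ?N2 ?addr0.
by rewrite coefD H1 ?H2 //; case: ifP; rewrite ?addr0.
Qed.

Lemma low_termM d1 d2 c1 c2 p1 p2 :
  low_term d1 c1 p1 -> low_term d2 c2 p2 ->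
  low_term (d1 + d2) (c1 * c2) (p1 * p2).
Proof.
move=> [H1 N1] [H2 N2]; split=> [m md|d0]; last first.
  have [d10|d10] := ltP d1 0; first by rewrite N1 ?mul0r.
  by rewrite N2 ?mulr0 //; lia.
rewrite coefM.
(* Since m <= d1 + d2, an index exceeding its lowest degree forces the other one strictly below its
   own. *)
have low (i : 'I_m.+1) : i%:Z != d1 \/ (m - i)%N%:Z != d2 ->
    p1`_i * p2`_(m - i) = 0.
  have [id1|id1] := leP i%:Z d1; last first.
    have := ltn_ord i => im _; rewrite [p2`__]H2; last by lia.
    by rewrite ifF ?mulr0 //; apply/eqP; lia.
  rewrite H1 //; case: eqP => [id [//|]|_ _]; last by rewrite mul0r.
  move=> ne; have [md2|md2] := leP (m - i)%N%:Z d2.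
    by rewrite H2 // (negPf ne) mulr0.
  by have := ltn_ord i; lia.
case: eqP => [mE|mne]; last first.
  apply: big1 => i _; apply: low.
  by case: (i%:Z =P d1) => [?|/eqP]; [right; apply/eqP; have := ltn_ord i;
    lia|left].
have [d10|d10] := ltP d1 0.
  rewrite N1 // mul0r; apply: big1 => i _; apply: low.
  by left; apply/eqP; lia.
have [d20|d20] := ltP d2 0.
  rewrite N2 // mulr0; apply: big1 => i _; apply: low.
  by right; apply/eqP; lia.
have lt_d1 : (`|d1| < m.+1)%N by lia.
rewrite (bigD1 (Ordinal lt_d1)) //= big1 ?addr0 => [|i].
  by rewrite H1 ?H2 ?ifT //; lia.
move=> /eqP ne; apply: low; left; apply/eqP => id1; apply: ne.
by apply: val_inj => /=; lia.
Qed.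

Lemma low_term_sign (s : nat) d c p :
  low_term d c p -> low_term d ((-1) ^+ s * c) ((-1) ^+ s * p).
Proof.
have -> : (-1) ^+ s = ((-1) ^+ s : R)%:P :> {poly R}
  by rewrite rmorphXn rmorphN.
by case=> H N; split=> [m md|/N ->]; rewrite ?mulr0 // coefCM H //; case: ifP;
  rewrite ?mulr0.
Qed.

Lemma low_term_sum (I : finType) d (c : I -> R) (p : I -> {poly R}) :
  (forall i, low_term d (c i) (p i)) -> low_term d (\sum_i c i) (\sum_i p i).
Proof.
move=> H; apply: (big_ind2 (low_term d)) => // [|c1 p1 c2 p2].
  exact: low_term0.
exact: low_termD.
Qed.

Lemma low_term_prod n (d : 'I_n -> int) (c : 'I_n -> R) (p : 'I_n -> {poly R}) :
  (forall i, low_term (d i) (c i) (p i)) ->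
  low_term (\sum_i d i) (\prod_i c i) (\prod_i p i).
Proof.
elim: n d c p => [|n IHn] d c p H.
  by rewrite !big_ord0; split=> // m m0; rewrite coef1; case: m m0.
by rewrite !big_ord_recl; apply: low_termM => //; apply: IHn.
Qed.

(** The weights along a permutation add up to a total independent of the permutation, so all Leibniz
    terms have the same lowest degree. *)
Lemma low_term_det n (a b : 'I_n -> int) (c : 'M[R]_n) (P : 'M[{poly R}]_n) :
  (forall i j, low_term (a i + b j) (c i j) (P i j)) ->
  low_term (\sum_i a i + \sum_i b i) (\det c) (\det P).
Proof.
move=> H; apply: low_term_sum => s; apply: low_term_sign.
rewrite [X in _ + X](reindex_inj (@perm_inj _ s)) /= -big_split /=.
by apply: low_term_prod => i; apply: H.
Qed.

End LowestTerm.

(** All the column operations together are right multiplication by one unitriangular matrix [T]. *)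
Lemma det_col_sub (R : comNzRingType) n (x : R) (F : nat -> nat -> R) :
  \det (\matrix_(i < n, j < n) F i j) =
  \det (\matrix_(i < n, j < n)
          if j == 0 :> nat then F i j else F i j - x * F i j.-1).
Proof.
pose T := \matrix_(k < n, j < n)
   ((k == j)%:R - (if k.+1 == j :> nat then x else 0)) : 'M[R]_n.
have detT : \det T = 1.
  rewrite -det_tr det_trig => [|]; last first.
    apply/is_trig_mxP => i j ij; rewrite !mxE ifF; last by apply/eqP; lia.
    by rewrite subr0; case: eqP => // e; move: ij; rewrite e ltnn.
  by apply: big1 => i _; rewrite !mxE eqxx ifF ?subr0 //; apply/eqP; lia.
rewrite -[LHS]mulr1 -detT -det_mulmx; congr (\det _).
apply/matrixP => i j; rewrite !mxE.
under eq_bigr => k _ do rewrite !mxE mulrBr.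
rewrite sumrB (bigD1 j) //= eqxx mulr1 big1 ?addr0; last first.
  by move=> k /negPf kj; rewrite kj mulr0.
case: eqP => j0.
  rewrite big1 ?subr0 // => k _; rewrite ifF ?mulr0 //; apply/eqP; lia.
have lt_j : (j.-1 < n)%N by have := ltn_ord j; lia.
rewrite (bigD1 (Ordinal lt_j)) //= ifT; last by apply/eqP; lia.
rewrite big1 => [|k /eqP kj]; first by rewrite addr0 mulrC.
rewrite ifF ?mulr0 //; apply/eqP => kj'; apply: kj; apply: val_inj => /=; lia.
Qed.

(** * Taylor's formula in the variable t_1 *)

Section Taylor.
Variables (C : numFieldType) (A : comNzRingType) (iota : {rmorphism C -> A}).
Variables (n : nat) (h : 'I_n.+1 -> A).

Let shift k : {poly A} := (h k)%:P + (if k == 0 :> nat then 'X else 0).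
Local Notation taylor := (mmap (polyC \o iota) shift).

Lemma taylor_deriv f : (taylor f)^`() = taylor (mderiv ord0 f).
Proof.
elim/mpolyind: f => [|c m f _ _ IHf]; first by rewrite !raddf0.
rewrite !raddfD /= IHf; congr (_ + _).
rewrite mderivZ !mmapZ derivM /= derivC mul0r add0r; congr (_ * _).
rewrite mderivX mmapZ !mmapX /mmap1 [in LHS](bigD1 ord0) // [in RHS](bigD1
  ord0) //=.
(* Only t_1 is shifted by 'X, so the other factors are constant. *)
have cst (k : 'I_n.+1 -> nat) : \prod_(i | i != ord0) shift i ^+ k i
    = (\prod_(i | i != ord0) h i ^+ k i)%:P.
  rewrite rmorph_prod; apply: eq_bigr => i i0; rewrite rmorphXn /= /shift.
  by rewrite ifF ?addr0 //; apply: contraNF i0 => /eqP i0; apply/eqP/val_inj.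
rewrite !cst derivM derivC mulr0 addr0 deriv_exp /= rmorph_nat rmorph_nat.
have -> : (shift ord0)^`() = 1 by rewrite /shift derivD derivC add0r derivX.
rewrite mul1r mulr_natl mulrnAl !mnmBE !mnm1E eqxx subn1; congr (_ * _%:P *+ _).
apply: eq_bigr => i /negPf i0; by rewrite mnmBE mnm1E eq_sym i0 subn0.
Qed.

Lemma taylor_coef0 f : (taylor f)`_0 = mmap iota h f.
Proof.
rewrite -horner_coef0 /mmap horner_sum; apply: eq_bigr => m _.
rewrite hornerM hornerC; congr (_ * _).
rewrite /mmap1 horner_prod; apply: eq_bigr => i _.
by rewrite horner_exp hornerD hornerC; case: ifP;
  rewrite ?hornerX ?horner0 addr0.
Qed.

Lemma mmap_iter_mderiv m f :
  mmap iota h (iter m (mderiv ord0) f) = m`!%:R * (taylor f)`_m.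
Proof.
have -> : mmap iota h (iter m (mderiv ord0) f) = ((taylor f)^`(m))`_0.
  rewrite -taylor_coef0; congr (nth 0 (polyseq _) 0).
  by elim: m => [|m IHm] //=; rewrite -taylor_deriv IHm.
by rewrite coef_derivn addn0 ffactnn mulr_natl.
Qed.

End Taylor.

(** * Parts of a partition and the number N' *)

Lemma partition_nth_gt0 mu i :
  is_partition mu -> (i < size mu)%N -> (0 < nth 0%N mu i)%N.
Proof. by case/andP => _ /all_nthP mu_gt0 /mu_gt0. Qed.

Lemma partition_nth_le mu i j :
  is_partition mu -> (i <= j)%N -> (nth 0%N mu j <= nth 0%N mu i)%N.
Proof.
case/andP => mu_sorted _ ij.
have [jl|jl] := ltnP j (size mu); last by rewrite nth_default.
have ge_trans : transitive (fun a b => (b <= a)%N).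
  by move=> a b c ab bc; apply: leq_trans bc ab.
have := sorted_leq_nth ge_trans (fun a => leqnn a) 0 mu_sorted.
by apply=> //; rewrite inE // (leq_ltn_trans ij).
Qed.

(** All parts are positive, so the truncated subtraction is exact and can be distributed. In this
    form N' can be compared part by part. *)
Lemma NprimeE mu : is_partition mu ->
  Nprime mu = (\sum_(i < (size mu).-1) (nth 0%N mu i.+1).-1)%N.
Proof.
move=> mu_ptn; rewrite /Nprime big_add1 /= big_mkord.
rewrite -[X in (_ - X)%N](_ : (\sum_(i < (size mu).-1) 1)%N = _); last first.
  by rewrite sum1_card card_ord.
rewrite -sumnB => [|i _]; last by rewrite partition_nth_gt0 //;
  have := ltn_ord i; lia.
by apply: eq_bigr => i _; rewrite subn1.
Qed.

(** * The lowest-order term in y of a Schur function *)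

Section SchurLowestTerm.
Variable C : numFieldType.

Definition invfact (z : int) : C := if z is Posz m then m`!%:R^-1 else 0.

(** Aitken's determinant for the diagram left after removing the first row and first column of [mu]:
    times N'!, it counts the standard tableaux of that shape. *)
Definition invfact_det (mu : seq nat) : C :=
  \det (\matrix_(i < (size mu).-1, j < (size mu).-1)
          invfact ((nth 0%N mu i.+1).-1%:Z - i%:Z + j%:Z)).

Variables (A : comNzRingType) (iota : {rmorphism C -> A}) (a1 a2 : A).
Local Notation E := (exp_coef (polyC \o iota) 'X).

Lemma low_term_exp_coef z : low_term z (iota (invfact z)) (E z).
Proof.
case: z => [m|m]; last by rewrite /= rmorph0; apply: low_term0.
split=> // k km; rewrite /= coefCM coefXn.
by case: (k =P m) => [->|ne]; [rewrite eqxx mulr1|rewrite ifF ?mulr0 //;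
  apply/eqP; lia].
Qed.

(** The first summand starts one degree higher, so the leading term comes from the second alone. *)
Lemma low_term_exp_coef_pair z :
  low_term (z - 1) (- a2 * iota (invfact (z - 1))) (E z - a2%:P * E (z - 1)).
Proof.
rewrite -[X in low_term _ X _]add0r -mulNr -rmorphN; apply: low_termD.
  by apply: low_term_pred; apply: low_term_exp_coef.
by rewrite -[z - 1]add0r; apply: low_termM; [have := low_term_coef0 (- a2)%:P;
  rewrite coefC|rewrite add0r; apply: low_term_exp_coef].
Qed.

Variable n : nat.
Variable h : 'I_n.+1 -> A.
Hypothesis hE : forall k, h k = iota (k.+1%:R^-1) * (a1 ^+ k.+1 - a2 ^+ k.+1).
Let shift k : {poly A} := (h k)%:P + (if k == 0 :> nat then 'X else 0).
Local Notation taylor := (mmap (polyC \o iota) shift).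

Lemma taylor_pfunz_rec z : z <= n.+1%:Z ->
  taylor (pfunz C n.+1 z) - a1%:P * taylor (pfunz C n.+1 (z - 1))
    = E z - a2%:P * E (z - 1).
Proof.
move=> zn; rewrite (@mmap_pfunz_rec _ _ _ a1%:P a2%:P 'X) //=.
  by ring.
by move=> k; rewrite /shift hE rmorphM rmorphB !rmorphXn.
Qed.

(** At y = 0 the generating function is (1 - a2 z)/(1 - a1 z). *)
Lemma taylor_pfunz_coef0 m : (m.+1 <= n.+1)%N ->
  (taylor (pfunz C n.+1 m.+1))`_0 = a1 ^+ m * (a1 - a2).
Proof.
have E0 k : (E (Posz k))`_0 = (k == 0%N)%:R.
  by rewrite /= coefCM coefXn; case: k => [|k];
    rewrite ?mulr0 // mulr1 invr1 rmorph1.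
elim: m => [|m IHm] mn.
  have := @taylor_pfunz_rec (Posz 1) _ =>
    /(_ isT)/(congr1 (fun p : {poly A} => p`_0)).
  rewrite (_ : Posz 1 - 1 = Posz 0) // !coefB (coefCM a1) (coefCM a2) !E0.
  have -> : pfunz C n.+1 (Posz 0) = 1.
    by rewrite /= /pfun big_ord1 expr0 coef1 invr1 scale1r.
  have -> : taylor 1 = 1 by exact: rmorph1.
  rewrite coef1 /=.
  by move=> /(canRL (subrK _)) ->; ring.
have := @taylor_pfunz_rec m.+2 _ => /(_ mn)/(congr1 (fun p : {poly A} => p`_0)).
rewrite (_ : Posz m.+2 - 1 = m.+1%:Z); last by lia.
rewrite !coefB (coefCM a1) (coefCM a2) !E0 IHm; last by lia.
by move=> /(canRL (subrK _)) ->; rewrite exprS /=; ring.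
Qed.

Lemma low_term_schur a rest :
  is_partition (a :: rest) -> (a + size rest < n.+1)%N ->
  low_term (Nprime (a :: rest))
    (a1 ^+ a.-1 * (a1 - a2) * (- a2) ^+ size rest * iota (invfact_det (a ::
      rest)))
    (taylor (schur C n.+1 (a :: rest))).
Proof.
move=> mu_ptn lt_n; set mu := a :: rest.
have a_gt0 : (0 < a)%N := @partition_nth_gt0 mu 0 mu_ptn isT.
pose Q z := taylor (pfunz C n.+1 z).
pose w (i : nat) : int := (nth 0%N mu i)%:Z - i%:Z.
have w_le i : w i <= a%:Z - i%:Z.
  have : (nth 0%N mu i <= a)%N := @partition_nth_le mu 0 i mu_ptn isT.
  by rewrite /w; lia.
have -> : taylor (schur C n.+1 mu) =
    \det (\matrix_(i < (size rest).+1, j < (size rest).+1) Q (w i + j%:Z)).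
  rewrite /schur -det_map_mx; congr (\det _).
  by apply/matrixP => i j; rewrite !mxE.
rewrite (@det_col_sub _ (size rest).+1 a1%:P (fun i j => Q (w i + j%:Z))).
(* Column 0 is not reduced. The weight -a gives degree 0 to its top entry and negative degree to the
   entries below, which puts no condition on them. *)
pose b (j : nat) : int := if j == 0%N then - a%:Z else j%:Z - 1.
pose c : 'M[A]_((size rest).+1) := \matrix_(i, j)
  if j == 0 :> nat then (if i == 0 :> nat then a1 ^+ a.-1 * (a1 - a2) else 0)
  else - a2 * iota (invfact (w i + j%:Z - 1)).
(* The weights of row 0 and column 0 cancel; each later row and its column together give the part
   minus one. *)
have -> : (Nprime mu)%:Z = \sum_(i < (size rest).+1) w i + \sum_(j < (size
  rest).+1) b j.
  rewrite !big_ord_recl NprimeE // addrACA.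
  have -> : w (ord0 : 'I_((size rest).+1)) + b (ord0 : 'I_((size rest).+1))
    = 0 by rewrite /w /b /=; lia.
  rewrite add0r -big_split /= (big_morph _ PoszD (erefl 0%:Z)).
  apply: eq_bigr => i _.
  have /= gt0 := @partition_nth_gt0 mu i.+1 mu_ptn (ltn_ord i).
  transitivity (w i.+1 + b i.+1) => //; rewrite /w /b /=; lia.
(* Column 0 of [c] has only its top entry, and each row of the remaining minor carries a factor -
   a2. *)
have -> : a1 ^+ a.-1 * (a1 - a2) * (- a2) ^+ size rest * iota (invfact_det mu)
  = \det c.
  rewrite (expand_det_col c ord0) big_ord_recl big1 ?addr0; last first.
    by move=> i _; rewrite !mxE /= mul0r.
  rewrite mxE /= -mulrA; congr (_ * _).
  rewrite /cofactor expr0 mul1r /invfact_det -det_map_mx -detZ; congr (\det _).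
  apply/matrixP => i j; rewrite !mxE /=; congr (_ * iota (invfact _)).
  have /= gt0 := @partition_nth_gt0 mu i.+1 mu_ptn (ltn_ord i).
  by transitivity (w i.+1 + j.+1%:Z - 1) => //; rewrite /w /=; lia.
apply: low_term_det => i j; rewrite !mxE /b; case: eqP => [->|/eqP j0].
  rewrite addr0; case: eqP => [->|i0].
    have -> : w 0%N + - a%:Z = 0 by rewrite /w /=; lia.
    rewrite -taylor_pfunz_coef0; last by lia.
    have -> : Q (w 0%N) = taylor (pfunz C n.+1 a.-1.+1).
      by rewrite /Q; congr (taylor (pfunz C n.+1 _)); rewrite /w /=; lia.
    exact: low_term_coef0.
  by apply: low_term_neg; have := w_le i; lia.
have -> : w i + j.-1%:Z = w i + j%:Z - 1 by lia.
rewrite addrA /Q taylor_pfunz_rec; first exact: low_term_exp_coef_pair.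
by have := w_le i; have := ltn_ord j; lia.
Qed.

End SchurLowestTerm.

(** * Inverse factorial determinants and the constant c_lambda *)

Lemma det_mxsub_perm (R : comNzRingType) n (s : 'S_n) (M : 'M[R]_n) :
  \det (\matrix_(i, j) M (s i) (s j)) = \det M.
Proof.
have -> : \matrix_(i, j) M (s i) (s j) = row_perm s (col_perm s M).
  by apply/matrixP => i j; rewrite !mxE.
rewrite row_permE col_permE !det_mulmx !det_perm odd_permV.
by rewrite mulrCA -signr_addb addbb mulr1.
Qed.

Section FallingVandermonde.
Variable R : comNzRingType.

Let ffpoly j : {poly R} := \prod_(k < j) ('X - k%:R%:P).

Lemma ffpoly_horner x j : (ffpoly j).[x%:R] = (x ^_ j)%:R.
Proof.
elim: j => [|j IHj]; first by rewrite /ffpoly big_ord0 hornerC.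
rewrite /ffpoly big_ord_recr /= hornerM IHj hornerXsubC ffactnSr natrM.
have [jx|xj] := leqP j x; first by rewrite natrB.
by rewrite ffact_small ?mul0r.
Qed.

(** The falling factorial of order j is monic of degree j in x, so a unitriangular change of basis
    reduces to the usual Vandermonde matrix. *)
Lemma det_ffact n (x : 'I_n -> nat) :
  \det (\matrix_(i < n, j < n) ((x i ^_ j)%:R : R)) =
  \prod_(i < n) \prod_(j < n | (i < j)%N) ((x j)%:R - (x i)%:R).
Proof.
have size_ff j : size (ffpoly j) = j.+1.
  by rewrite /ffpoly -big_enum /= size_prod_XsubC size_enum_ord.
pose U : 'M[R]_n := \matrix_(j, k) (ffpoly j)`_k.
have detU : \det U = 1.
  rewrite det_trig; last first.
    by apply/is_trig_mxP => i j ij; rewrite mxE nth_default ?size_ff.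
  apply: big1 => i _; rewrite mxE.
  have : ffpoly i \is monic by apply: monic_prod_XsubC.
  by rewrite monicE lead_coefE size_ff => /eqP.
have := det_Vandermonde (\row_j (x j)%:R : 'rV[R]_n).
under [RHS]eq_bigr => i _ do under eq_bigr => j _ do rewrite !mxE.
move=> <-; rewrite -[RHS]mul1r -[X in X * _]detU -det_mulmx -det_tr;
  congr (\det _).
apply/matrixP => i j; rewrite !mxE -ffpoly_horner.
rewrite (horner_coef_wide (n := n)) ?size_ff //; apply: eq_bigr => k _.
by rewrite !mxE.
Qed.

End FallingVandermonde.

Section HookLengths.
Variable C : numFieldType.

(** Taking 1/x_i! out of row i leaves falling factorials; both sides of 1/(x - j)! = x^_j / x!
    vanish when j > x. *)
Lemma det_invfact n (x : 'I_n -> nat) :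
  \det (\matrix_(i < n, j < n) invfact C ((x i)%:Z - j%:Z)) =
  (\prod_(i < n) (x i)`!%:R)^-1 *
  \prod_(i < n) \prod_(j < n | (i < j)%N) ((x j)%:R - (x i)%:R).
Proof.
rewrite -det_ffact -prodfV.
have -> : \prod_(i < n) ((x i)`!%:R)^-1
    = \det (diag_mx (\row_(i < n) ((x i)`!%:R^-1 : C))).
  by rewrite det_diag; apply: eq_bigr => i _; rewrite mxE.
rewrite -det_mulmx; congr (\det _); apply/matrixP => i j.
rewrite mul_diag_mx !mxE; have [jx|xj] := leqP j (x i).
  have -> : (x i)%:Z - j%:Z = (x i - j)%N by lia.
  rewrite /= -(ffact_fact jx) natrM invfM mulrAC mulVf ?mul1r //.
  by rewrite pnatr_eq0 -lt0n ffact_gt0.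
rewrite ffact_small // mulr0.
have : (x i)%:Z - j%:Z < 0 by lia.
by case: ((x i)%:Z - j%:Z).
Qed.

Lemma c_lamE lam : is_partition lam -> (0 < size lam)%N ->
  c_lam C lam = (Nprime lam)`!%:R * invfact_det C lam.
Proof.
move=> lam_ptn lam_gt0; set n := (size lam).-1.
have szE : size lam = n.+1 by rewrite /n prednK.
pose x (i : 'I_n) : nat := (wseq lam i.+1).-1.
have xE i : x i = ((nth 0%N lam (n - i)).-1 + i)%N.
  have := @partition_nth_gt0 lam (n - i) lam_ptn.
  by rewrite /x /wseq szE subSS; have := ltn_ord i; lia.
have -> : invfact_det C lam
  = \det (\matrix_(i < n, j < n) invfact C ((x i)%:Z - j%:Z)).
  (* The w_i are numbered from the last part upwards, so rows and columns are both reversed; the two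
     signs cancel. *)
  rewrite /invfact_det -/n -(det_mxsub_perm (perm (@rev_ord_inj n))).
  congr (\det _); apply/matrixP => i j; rewrite !mxE !permE xE /=.
  have -> : (n - i.+1).+1 = (n - i)%N by have := ltn_ord i; lia.
  by congr (invfact _ _); have := ltn_ord i; have := ltn_ord j; lia.
rewrite det_invfact /c_lam -mulrA szE big_add1 /= big_mkord.
congr (_ * (_ * _)); rewrite big_add1 /= big_mkord; apply: eq_bigr => i _.
rewrite big_add1 /= big_geq_mkord; apply: eq_bigr => j _.
have w_gt0 (k : 'I_n) : (0 < wseq lam k.+1)%N.
  have := @partition_nth_gt0 lam (n - k) lam_ptn.
  by rewrite /wseq szE subSS; have := ltn_ord k; lia.
have x1 k : (x k)%:R = (wseq lam k.+1)%:R - 1 :> C.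
  by rewrite /x -[in LHS]subn1 natrB ?w_gt0.
by rewrite !x1; ring.
Qed.

(** A zero part at the bottom gives the last row (0, .., 0, 1), because 1/z! is 0 for negative z. *)
Lemma det_invfact_pad n (k : nat -> nat) s :
  (forall i, (n <= i)%N -> k i = 0%N) ->
  \det (\matrix_(i < n + s, j < n + s) invfact C ((k i)%:Z - i%:Z + j%:Z)) =
  \det (\matrix_(i < n, j < n) invfact C ((k i)%:Z - i%:Z + j%:Z)).
Proof.
move=> k0; elim: s => [|s IHs]; first by rewrite addn0.
rewrite addnS -IHs (expand_det_row _ ord_max) (bigD1 ord_max) //= big1 ?addr0.
  rewrite mxE /= k0 ?leq_addr // sub0r addNr /= invr1 mul1r.
  rewrite /cofactor -signr_odd addnn odd_double expr0 mul1r; congr (\det _).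
  by apply/matrixP => i j; rewrite !mxE !lift_max.
move=> j ne_j; rewrite mxE /= k0 ?leq_addr // sub0r.
have : - (n + s)%N%:Z + j%:Z < 0.
  have : (j != n + s :> nat)%N by apply: contraNneq ne_j => ?;
    apply/eqP/val_inj.
  by have := ltn_ord j; lia.
by case: (- _ + _) => // ? _; rewrite mul0r.
Qed.

(** The first part does not enter, and parts equal to 1 become zero parts once the first column is
    removed. *)
Lemma invfact_det_pad a b s0 s :
  invfact_det C (a :: s0 ++ nseq s 1%N) = invfact_det C (b :: s0).
Proof.
pose k i := (nth 0%N s0 i).-1.
rewrite /invfact_det /= size_cat size_nseq -(@det_invfact_pad _ k s) => [|i ?].
  congr (\det _); apply/matrixP => i j; rewrite !mxE /k nth_cat nth_nseq.
  case: ltnP => // h; rewrite ifT; last by have := ltn_ord i; lia.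
  by rewrite [nth 0%N s0 i]nth_default.
by rewrite /k nth_default.
Qed.

Lemma invfact_det_hook a s : invfact_det C (a :: nseq s 1%N) = 1.
Proof. by rewrite -[nseq s _]cat0s (@invfact_det_pad a a [::]) /invfact_det
  det_mx00. Qed.

End HookLengths.

(** * Derivatives of Schur functions at [x1] - [x2] *)

Section SchurEvaluation.
Variable C : numFieldType.

(* The coefficient of [x1^i x2^j] in
   [s_(a, 1^r) ([x1] - [x2]) = (- x2)^r x1^(a - 1) (x1 - x2)]. *)
Definition hook_coef (a r i j : nat) : C :=
  (-1) ^+ r * (((i == a) && (j == r))%:R - ((i.+1 == a) && (j == r.+1))%:R).

Lemma coef_hook a r i j : (0 < a)%N ->
  (('X ^+ a.-1 * ('X - 'X%:P) * (- 'X%:P) ^+ r : {poly {poly C}})`_i)`_j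
    = hook_coef a r i j.
Proof.
move=> a_gt0.
have -> : 'X ^+ a.-1 * ('X - 'X%:P) * (- 'X%:P) ^+ r =
   ((-1) ^+ r)%:P%:P * ('X^a * ('X^r)%:P - 'X ^+ a.-1 * ('X ^+ r.+1)%:P) :>
     {poly {poly C}}.
  have -> : ((-1) ^+ r)%:P%:P = (-1) ^+ r :> {poly {poly C}}.
    by rewrite !polyC_exp !polyCN !polyC1.
  rewrite [(- 'X%:P) ^+ r]exprNn !rmorphXn /= [X in _ * (_ - _ * X)]exprS.
  by case: a a_gt0 => // b _; rewrite /= [X in _ * (X * _ - _)]exprS; ring.
rewrite !coefCM coefB !coefMC !coefXn /hook_coef coefB !mulr_natl !coefMn
  !coefXn.
have -> : (i == a.-1) = (i.+1 == a) by lia.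
by case: (i == a); case: (i.+1 == a).
Qed.

(** The derivative is m! times a Taylor coefficient, and [low_term_schur] gives these coefficients
    only up to order N', whence the bound on [m]. *)
Lemma dschur_evE a rest m i j : is_partition (a :: rest) ->
  (m <= Nprime (a :: rest))%N ->
  ((dschur_ev (@pt_x1x2 C) m (a :: rest))`_i)`_j =
    if m == Nprime (a :: rest) then
      m`!%:R * invfact_det C (a :: rest) * hook_coef a (size rest) i j
    else 0.
Proof.
move=> mu_ptn mN; have a_gt0 : (0 < a)%N by case/andP: mu_ptn => _ /andP[].
pose iota : {rmorphism C -> {poly {poly C}}} := polyC \o polyC.
pose h (k : 'I_(a + (size rest).+1).+1) := pt_x1x2 C k.+1.
have hE k : h k = iota (k.+1%:R^-1) * ('X ^+ k.+1 - 'X%:P ^+ k.+1).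
  by rewrite /h /pt_x1x2 polyC_exp.
have [|low _] := low_term_schur hE mu_ptn; first by rewrite addnS ltnS leqnSn.
have -> : dschur_ev (@pt_x1x2 C) m (a :: rest) = mmap iota h
   (iter m (mderiv ord0) (schur C (a + (size rest).+1).+1 (a :: rest))) by [].
rewrite mmap_iter_mderiv low; last by lia.
rewrite eqz_nat; case: eqP => _; last by rewrite mulr0 !coef0.
rewrite -(coef_hook (size rest) i j a_gt0).
have -> (p : {poly {poly C}}) : m`!%:R * (p * iota (invfact_det C (a :: rest)))
  =
   (m`!%:R * invfact_det C (a :: rest))%:P%:P * p.
  by rewrite !polyCM !polyC_natr /=; ring.
by rewrite !coefCM.
Qed.

End SchurEvaluation.

(** * The finite codes enumerate partitions bijectively *)

Section Codes.
Local Open Scope nat_scope.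
Local Notation geqn := (fun a b => b <= a).

Lemma geqn_trans : transitive geqn.
Proof. by move=> a b c ab bc; apply: leq_trans bc ab. Qed.

(** In a weakly decreasing sequence the zeros come last, so removing them shifts no entry. *)
Lemma nth_filter_gt0 s i : sorted geqn s ->
  nth 0 [seq x <- s | 0 < x] i = nth 0 s i.
Proof.
elim: s i => // a s IHs i /= s_sorted; case: ifP => a0.
  by case: i => //= i; rewrite IHs ?(path_sorted s_sorted).
have {a0} a0 : a = 0 by lia.
have /allP s0 : all (geqn a) s by apply: order_path_min s_sorted;
  apply: geqn_trans.
have -> : [seq x <- s | 0 < x] = [::].
  by apply/eqP; rewrite -[_ == _]negbK -has_filter; apply/hasPn => x /s0;
    rewrite a0; lia.
rewrite nth_nil; case: i => //= i; have [il|il] := ltnP i (size s).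
  by have /= := s0 _ (mem_nth 0 il); rewrite a0; lia.
by rewrite nth_default.
Qed.

(** With positive entries, the default 0 of [nth] reveals the length. *)
Lemma pos_nth_inj s t : all (leq 1) s -> all (leq 1) t ->
  (forall i, nth 0 s i = nth 0 t i) -> s = t.
Proof.
elim: s t => [|a s IHs] [|b t] //=.
- by move=> _ /andP[b0 _] /(_ 0) /= E; move: b0; rewrite -E.
- by move=> /andP[b0 _] _ /(_ 0) /= E; move: b0; rewrite E.
- move=> /andP[_ s0] /andP[_ t0] E.
  have /= -> := E 0; rewrite (IHs t) // => i; apply: (E i.+1).
Qed.

Lemma sum_nth_le s D : \sum_(i < D) nth 0 s i <= sumn s.
Proof.
elim: s D => [|a s IHs] [|D]; rewrite ?big_ord0 //.
  by rewrite big1 // => i _; rewrite nth_nil.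
by rewrite big_ord_recl leq_add2l IHs.
Qed.

Lemma size_le_sumn s : all (leq 1) s -> size s <= sumn s.
Proof. by elim: s => //= a s IHs /andP[a0 /IHs]; lia. Qed.

Variable D : nat.
Implicit Types f : {ffun 'I_D -> 'I_D.+1}.

Lemma code_sorted f : ptn_code f -> sorted geqn [seq (f i : nat) | i <- enum
  'I_D].
Proof.
case/andP => /forallP f_mono _.
have : sorted ltn (map val (enum 'I_D)) by rewrite val_enum_ord iota_ltn_sorted.
rewrite !sorted_map; apply: sub_sorted => i j ij.
by have /forallP/(_ j)/implyP := f_mono i; apply; apply: ltnW.
Qed.

Lemma ptn_of_partition f : ptn_code f -> is_partition (ptn_of f).
Proof.
move=> /code_sorted f_sorted; rewrite /is_partition /ptn_of filter_all andbT.
exact: sorted_filter geqn_trans _ _ f_sorted.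
Qed.

Lemma nth_ptn_of f (i : 'I_D) : ptn_code f -> nth 0 (ptn_of f) i = f i.
Proof.
move=> /code_sorted /nth_filter_gt0 ->.
by rewrite (nth_map i) ?size_enum_ord // nth_ord_enum.
Qed.

Lemma ptn_of_inj f g : ptn_code f -> ptn_code g -> ptn_of f = ptn_of g -> f = g.
Proof.
move=> f_code g_code E; apply/ffunP => i; apply: val_inj => /=.
by rewrite -!nth_ptn_of // E.
Qed.

Lemma ptn_of_surj mu : is_partition mu -> sumn mu <= D ->
  exists2 f : {ffun 'I_D -> 'I_D.+1}, ptn_code f & ptn_of f = mu.
Proof.
move=> mu_ptn mu_le; have /andP[_ mu_gt0] := mu_ptn.
have nth_le i : nth 0 mu i <= D.
  apply: leq_trans mu_le; apply: leq_trans (sum_nth_le mu i.+1).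
  by rewrite big_ord_recr leq_addl.
have size_le : size mu <= D.
  exact: leq_trans (size_le_sumn mu_gt0) mu_le.
pose f := [ffun i : 'I_D => inord (nth 0 mu i)] : {ffun 'I_D -> 'I_D.+1}.
have fE i : f i = nth 0 mu i :> nat by rewrite ffunE inordK // ltnS.
have f_code : ptn_code f.
  apply/andP; split.
    apply/forallP => i; apply/forallP => j; apply/implyP => ij.
    by rewrite !fE; apply: partition_nth_le.
  under eq_bigr => i _ do rewrite fE.
  exact: leq_trans (sum_nth_le mu D) mu_le.
exists f => //; have /andP[_ f_gt0] := ptn_of_partition f_code.
apply: pos_nth_inj => // i; have [iD|iD] := ltnP i D.
  by rewrite (nth_ptn_of (Ordinal iD)) // fE.
rewrite !nth_default ?(leq_trans size_le) // (leq_trans _ iD) //.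
by rewrite size_filter (leq_trans (count_size _ _)) // size_map size_enum_ord.
Qed.

(** Writes one isolated value as a sum over codes, for termwise comparison with [tau_ev]. *)
Lemma sum_codes (V : nmodType) mu (v : V) :
  (v != 0%R -> is_partition mu /\ sumn mu <= D) ->
  (\sum_(f : {ffun 'I_D -> 'I_D.+1} | ptn_code f) if ptn_of f == mu then v else
    0)%R = v.
Proof.
have [-> _|_ /(_ isT) [mu_ptn mu_le]] := eqVneq v 0%R.
  by rewrite big1 // => f _; rewrite if_same.
have [f f_code fE] := ptn_of_surj mu_ptn mu_le.
rewrite (bigD1 f) //= fE eqxx big1 ?GRing.addr0 // => g /andP[g_code gf].
by case: eqP => // gE; case/eqP: gf; apply: ptn_of_inj; rewrite ?fE.
Qed.

End Codes.

(** * Series supported on a family of extended hooks *)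

Section TauEvaluation.
Variable C : numFieldType.

(* The partition [(a, s0, 1, .., 1)] of length [r + 1]; only meaningful for
   [size s0 <= r], since the subtraction is truncated. *)
Definition hook_family (s0 : seq nat) a r := a :: s0 ++ nseq (r - size s0) 1%N.

Lemma hook_family_inj s0 a r b q : (size s0 <= r)%N -> (size s0 <= q)%N ->
  (hook_family s0 a r == hook_family s0 b q) = (a == b) && (r == q).
Proof.
move=> sr sq; apply/eqP/andP => [[-> /(congr1 size)]|[/eqP-> /eqP->]] //.
by rewrite !size_cat !size_nseq => rq; split=> //; apply/eqP; lia.
Qed.

Variables (s0 : seq nat) (b : seq nat -> C) (m : nat) (K : C).
Hypothesis b_hook : forall mu, is_partition mu -> b mu != 0 ->
  (exists a r, [/\ (size s0 <= r)%N, mu = hook_family s0 a r &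
      forall i j, ((dschur_ev (@pt_x1x2 C) m mu)`_i)`_j
        = K * hook_coef C a r i j])
  \/ ((forall i j, ((dschur_ev (@pt_x1x2 C) m mu)`_i)`_j = 0) /\
      forall a r, (size s0 <= r)%N -> mu <> hook_family s0 a r).
Hypothesis b_supp : forall a r, (size s0 <= r)%N -> b (hook_family s0 a r) != 0
  ->
  is_partition (hook_family s0 a r) /\ sumn (hook_family s0 a r)
    = (a + r + m)%N.

Let u a r := if (size s0 <= r)%N then b (hook_family s0 a r) else 0.

(** By [hook_coef], the member (a, r) contributes only at x1^a x2^r and x1^(a-1) x2^(r+1). Hence (i,
    j) receives only the members (i, j) and (i+1, j-1), both with sign (-1)^j. This serves tau, with
    [s0] the tail of [lam], and tau_2, with [s0] empty. *)
Lemma tau_ev_hooks i j :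
  tau_ev b m (@pt_x1x2 C) i j =
    K * ((-1) ^+ j * (u i j + if j is j'.+1 then u i.+1 j' else 0)).
Proof.
pose v2 := if j is j'.+1 then u i.+1 j' else 0.
(* At j = 0 the predecessor in [mu2] is harmless, since [v2] is then 0. *)
pose mu1 := hook_family s0 i j; pose mu2 := hook_family s0 i.+1 j.-1.
rewrite -/v2 mulrDr mulrDr /tau_ev.
(* Both surviving terms become sums over codes, so the identity is checked one partition at a time;
   [b_supp] ensures that [mu1] and [mu2] obey the size bound. *)
rewrite -[K * (_ * u i j)](@sum_codes (i + j + m) _ mu1); last first.
  rewrite /u; case: ifP => [sj|_]; last by rewrite !mulr0 eqxx.
  rewrite !mulf_eq0 !negb_or => /and3P[_ _ bn0].
  by have [? ->] := b_supp sj bn0.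
rewrite -[K * (_ * v2)](@sum_codes (i + j + m) _ mu2); last first.
  rewrite /v2 /mu2 /u; case: (j) => [|j']; first by rewrite !mulr0 eqxx.
  case: ifP => [sj|_]; last by rewrite !mulr0 eqxx.
  rewrite !mulf_eq0 !negb_or => /and3P[_ _ bn0].
  by have [? ->] := b_supp sj bn0; split=> //; lia.
rewrite -big_split /=; apply: eq_bigr => f /ptn_of_partition.
move: (ptn_of f) => mu mu_ptn {f}.
have [b0|bn0] := eqVneq (b mu) 0.
  rewrite b0 mul0r.
  have -> : (if mu == mu1 then K * ((-1) ^+ j * u i j) else 0) = 0.
    by case: eqP => // E; rewrite /u -/mu1 -E b0 if_same !mulr0.
  rewrite add0r; case: eqP => //; rewrite /mu2 /v2; case: (j) => [|j'] E.
    by rewrite !mulr0.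
  by rewrite /u -E b0 if_same !mulr0.
case: (b_hook mu_ptn bn0) => [[a [r [sr muE ->]]]|[-> mu_ne]]; last first.
  rewrite mulr0; have -> : (if mu == mu1 then K * ((-1) ^+ j * u i j) else 0) =
    0.
    case: eqP => // E; rewrite /u; case: ifP => sj; last by rewrite !mulr0.
    by case: (mu_ne _ _ sj E).
  rewrite add0r; case: eqP => //; rewrite /mu2 /v2; case: (j) => [|j'] E.
    by rewrite !mulr0.
  rewrite /u; case: ifP => sj; last by rewrite !mulr0.
  by case: (mu_ne _ _ sj E).
have -> : (if mu == mu1 then K * ((-1) ^+ j * u i j) else 0)
   = K * ((-1) ^+ r * ((i == a) && (j == r))%:R * b mu).
  have [sj|sj] := leqP (size s0) j; last first.
    have -> : (j == r) = false by lia.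
    by rewrite /u leqNgt sj /= andbF !(mulr0, mul0r) if_same.
  rewrite {1}muE hook_family_inj // [a == i]eq_sym [r == j]eq_sym.
  case: eqP => [ia|_] /=; last by rewrite !(mulr0, mul0r).
  case: eqP => [jr|_] /=; last by rewrite !(mulr0, mul0r).
  by rewrite /u sj ia jr muE mulr1.
have -> : (if mu == mu2 then K * ((-1) ^+ j * v2) else 0)
   = K * (- (-1) ^+ r * ((i.+1 == a) && (j == r.+1))%:R * b mu).
  rewrite /mu2 /v2; case: (j) => [|j'] /=.
    by rewrite andbF !(mulr0, mul0r) if_same.
  rewrite eqSS; have [sj|sj] := leqP (size s0) j'; last first.
    have -> : (j' == r) = false by lia.
    by rewrite /u leqNgt sj /= andbF !(mulr0, mul0r) if_same.
  rewrite {1}muE hook_family_inj // [a == _]eq_sym [r == _]eq_sym.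
  case: eqP => [ia|_] /=; last by rewrite !(mulr0, mul0r).
  case: eqP => [jr|_] /=; last by rewrite !(mulr0, mul0r).
  by rewrite /u sj ia jr muE mulr1 exprS mulN1r.
rewrite /hook_coef; ring.
Qed.

End TauEvaluation.

(** * Multiplication of formal series by monomials *)

Section FormalSeries.
Variable C : fieldType.
Implicit Types F G : fps C.

Lemma fps_mulC F G i j : fps_mul F G i j = fps_mul G F i j.
Proof.
rewrite /fps_mul (reindex_inj rev_ord_inj); apply: eq_bigr => a _.
rewrite (reindex_inj rev_ord_inj); apply: eq_bigr => b _ /=.
rewrite mulrC !subSS !subKn //; [have := ltn_ord b|have := ltn_ord a]; lia.
Qed.

Lemma fps_mul_mono a b F i j :
  fps_mul (fps_mono C a b) F i j =
    if (a <= i)%N && (b <= j)%N then F (i - a)%N (j - b)%N else 0.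
Proof.
rewrite /fps_mul /fps_mono; have [ai|ia] := leqP a i; last first.
  rewrite big1 // => a' _; rewrite big1 // => b' _.
  by rewrite ifF ?mul0r //; have := ltn_ord a'; lia.
rewrite (bigD1 (Ordinal (ai : (a < i.+1)%N))) //= [X in _ + X]big1 ?addr0;
  last first.
  move=> a' ne; rewrite big1 // => b' _; rewrite ifF ?mul0r //.
  by rewrite -val_eqE /= in ne; rewrite (negPf ne).
have [bj|jb] := leqP b j; last first.
  rewrite big1 // => b' _.
  by rewrite ifF ?mul0r //; have := ltn_ord b'; lia.
rewrite (bigD1 (Ordinal (bj : (b < j.+1)%N))) //= [X in _ + X]big1 ?addr0;
  last first.
  move=> b' ne; rewrite ifF ?mul0r //.
  by rewrite -val_eqE /= in ne; rewrite (negPf ne) andbF.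
by rewrite !eqxx mul1r.
Qed.

Lemma fps_mul_mono_sub p k G i j :
  fps_mul (fps_mul (fps_mono C p k)
             (fps_add (fps_mono C 1 0) (fps_scale (-1) (fps_mono C 0 1)))) G i
               j =
  (if (p.+1 <= i)%N && (k <= j)%N then G (i - p.+1)%N (j - k)%N else 0)
  - (if (p <= i)%N && (k.+1 <= j)%N then G (i - p)%N (j - k.+1)%N else 0).
Proof.
rewrite -!fps_mul_mono /fps_mul -sumrB; apply: eq_bigr => a _.
rewrite -sumrB; apply: eq_bigr => b _; rewrite -mulrBl; congr (_ * _).
rewrite -/(fps_mul _ _ _ _) fps_mul_mono /fps_add /fps_scale /fps_mono.
move: (a : nat) (b : nat) => {}a {}b.
have [pa|ap] := leqP p a; last first.
  by rewrite /= !ifF ?subr0 //; lia.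
have [kb|bk] := leqP k b; last first.
  by rewrite /= !ifF ?subr0 //; lia.
have -> : ((a - p)%N == 1%N) && ((b - k)%N == 0%N)
  = (a == p.+1) && (b == k) by lia.
have -> : ((a - p)%N == 0%N) && ((b - k)%N == 1%N)
  = (a == p) && (b == k.+1) by lia.
by rewrite mulN1r.
Qed.

End FormalSeries.

(** * The support of tau and the four claims *)

Lemma Nprime_cons a s : Nprime (a :: s) = (sumn s - size s)%N.
Proof. by rewrite /Nprime big_add1 /= sumnE [in RHS](big_nth 0%N). Qed.

(** An appended 1 adds equally to sum and length, and N' ignores the first part. *)
Lemma Nprime_hook_family b s0 a r :
  Nprime (hook_family s0 a r) = Nprime (b :: s0).
Proof.
rewrite !Nprime_cons sumn_cat sumn_nseq size_cat size_nseq mul1n.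
by rewrite subnDr.
Qed.

Lemma hook_family_partition b s0 a r : is_partition (b :: s0) -> (b <= a)%N ->
  is_partition (hook_family s0 a r).
Proof.
move=> /andP[/= s_sorted /andP[b0 s_gt0]] ba; apply/andP; split; last first.
  by rewrite /= all_cat s_gt0 (leq_trans b0 ba) all_nseq orbT.
rewrite /= cat_path; apply/andP; split.
  by case: (s0) s_sorted => //= c s /andP[cb ->]; rewrite (leq_trans cb ba).
have : (0 < last a s0)%N.
  case: (s0) s_gt0 => [_|c s s_gt0]; first exact: leq_trans b0 ba.
  exact: (allP s_gt0 _ (mem_last c s)).
by elim: (r - _)%N (last _ _) => //= s IHs x x0; rewrite x0 IHs.
Qed.

Section Tau.
Variables (C : numFieldType) (lam : seq nat) (xi : seq nat -> C).
Hypotheses (lam_ptn : is_partition lam) (lam_gt0 : (0 < size lam)%N).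

Let lam1 := head 0%N lam.
Let k := (size lam).-1.
Let s0 := behead lam.

Lemma lam_cons : lam = lam1 :: s0.
Proof. by rewrite /lam1 /s0; case: lam lam_gt0. Qed.

Lemma size_s0 : size s0 = k.
Proof. by rewrite size_behead. Qed.

Lemma lam1_gt0 : (0 < lam1)%N.
Proof. by have := lam_ptn; rewrite lam_cons => /andP[_ /andP[]]. Qed.

Lemma tau_coef_supp mu i : tau_coef lam xi mu != 0 -> (nth 0%N lam i <= nth 0%N
  mu i)%N.
Proof.
rewrite /tau_coef; case: (mu =P lam) => [->//|_]; case: ifP => [|_];
  last by rewrite eqxx.
case/andP => /allP le_lam _ _; have [il|il] := ltnP i (size lam).
  by apply: le_lam; rewrite mem_iota.
by rewrite nth_default.
Qed.

Lemma tau_coef_supp1 a s : tau_coef lam xi (a :: s) != 0 -> (lam1 <= a)%N.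
Proof. by move=> /(@tau_coef_supp _ 0); rewrite nth0. Qed.

(** N' is a sum of parts minus one, hence monotone part by part; the equality case isolates the
    partitions that survive in tau_2. *)
Lemma tau_coef_Nprime mu : is_partition mu -> tau_coef lam xi mu != 0 ->
  exists a rest, [/\ mu = a :: rest, (Nprime lam <= Nprime mu)%N &
    Nprime mu = Nprime lam ->
      (size s0 <= size rest)%N /\ mu = hook_family s0 a (size rest)].
Proof.
case: mu => [|a rest] mu_ptn bn0.
  by have := tau_coef_supp 0 bn0; rewrite nth0 leqNgt lam1_gt0.
exists a, rest.
have le_size : (size lam <= (size rest).+1)%N.
  rewrite leqNgt; apply/negP => /(partition_nth_gt0 lam_ptn).
  by rewrite ltnNge (leq_trans (tau_coef_supp _ bn0)) // nth_default.
have NlamE : Nprime lam = (\sum_(i < size rest) (nth 0%N lam i.+1).-1)%N.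
  (* Past the end of [lam] the default 0 has predecessor 0, so the sum extends to the length of
     [mu]. *)
  rewrite NprimeE // (big_ord_widen (size rest) (fun i =>
    (nth 0%N lam i.+1).-1)); last by lia.
  rewrite big_mkcond; apply: eq_bigr => i _; case: ifP => // il.
  by rewrite nth_default //; lia.
have le_nth (i : 'I_(size rest)) : true ->
    ((nth 0%N lam i.+1).-1 <= (nth 0%N (a :: rest) i.+1).-1
       ?= iff ((nth 0%N lam i.+1).-1 == (nth 0%N (a :: rest) i.+1).-1))%N.
  by move=> _; apply: leqif_eq; have := tau_coef_supp i.+1 bn0; rewrite /=; lia.
have [] := leqif_sum le_nth.
rewrite -NlamE -(NprimeE mu_ptn) => le_N eq_N; split=> // NE.
have ls0 : (size s0 <= size rest)%N by rewrite size_s0 /k; lia.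
split=> //; rewrite /hook_family; congr (_ :: _).
have /andP[_ /andP[_ rest_gt0]] := mu_ptn.
apply: pos_nth_inj => // [|i].
  rewrite all_cat all_nseq orbT andbT.
  by have := lam_ptn; rewrite lam_cons => /andP[_ /andP[]].
have [ir|ir] := ltnP i (size rest); last first.
  by rewrite !nth_default // size_cat size_nseq subnKC.
(* Equal sums force equal summands. Positivity recovers the parts from their predecessors, giving 1
   where [lam] has ended. *)
have := eq_N; rewrite NE eqxx =>
  /esym/forallP/(_ (Ordinal ir))/implyP/(_ isT)/eqP /= E.
have r0 : (0 < nth 0%N rest i)%N by have /all_nthP := rest_gt0; apply.
rewrite nth_cat nth_nseq; move: E; rewrite -[nth _ lam i.+1]nth_behead -/s0.
have [is0|is0] := ltnP i (size s0).
  have := @partition_nth_gt0 lam i.+1 lam_ptn.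
  by rewrite -[nth _ lam i.+1]nth_behead -/s0; move: is0; rewrite size_s0 /k;
    lia.
by rewrite [nth _ s0 i]nth_default // ifT; lia.
Qed.

(** The dichotomy required by [tau_ev_hooks]. The constant is the same for the whole family because
    N' and [invfact_det] are. *)
Lemma dschur_ev_tau mu : is_partition mu -> tau_coef lam xi mu != 0 ->
  (exists a r, [/\ (size s0 <= r)%N, mu = hook_family s0 a r &
      forall i j, ((dschur_ev (@pt_x1x2 C) (Nprime lam) mu)`_i)`_j
                    = c_lam C lam * hook_coef C a r i j])
  \/ ((forall i j, ((dschur_ev (@pt_x1x2 C) (Nprime lam) mu)`_i)`_j = 0) /\
      forall a r, (size s0 <= r)%N -> mu <> hook_family s0 a r).
Proof.
move=> mu_ptn /(tau_coef_Nprime mu_ptn) [a [rest [muE le_N eq_N]]].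
have [NE|NE] := eqVneq (Nprime lam) (Nprime mu); last first.
  right; split=> [i j|b r sr E].
    by rewrite muE dschur_evE -?muE // (negPf NE).
  by move: NE; rewrite E (Nprime_hook_family lam1) -lam_cons eqxx.
have [sr hookE] := eq_N (esym NE); left; exists a, (size rest); split=> //.
move=> i j; rewrite {1}muE dschur_evE -?muE // -NE eqxx c_lamE //.
by rewrite hookE [in RHS]lam_cons (invfact_det_pad C a lam1) -lam_cons.
Qed.

(* The coefficient of the hook [(a, 1^r)] in [tau_2]. *)
Let U a r : C := if (k <= r)%N then tau_coef lam xi (hook_family s0 a r) else 0.

Lemma hook_family_sumn a r : (size s0 <= r)%N ->
  sumn (hook_family s0 a r) = (a + r + Nprime lam)%N.
Proof.
move=> sr; rewrite [in Nprime _]lam_cons Nprime_cons /= sumn_cat sumn_nseq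
  mul1n.
have /size_le_sumn : all (leq 1) s0.
  by have := lam_ptn; rewrite lam_cons => /andP[_ /andP[]].
by lia.
Qed.

Lemma tau_evE i j :
  tau_ev (tau_coef lam xi) (Nprime lam) (@pt_x1x2 C) i j =
    c_lam C lam * ((-1) ^+ j * (U i j + if j is j'.+1 then U i.+1 j' else 0)).
Proof.
rewrite (tau_ev_hooks dschur_ev_tau) => [|a r sr bn0].
  by rewrite /U -size_s0.
split; last exact: hook_family_sumn.
apply: (@hook_family_partition lam1); last exact: tau_coef_supp1 bn0.
by rewrite -lam_cons.
Qed.

Lemma tau_ev_eq0 m i j : (m < Nprime lam)%N ->
  tau_ev (tau_coef lam xi) m (@pt_x1x2 C) i j = 0.
Proof.
move=> mN; apply: big1 => f /ptn_of_partition; move: (ptn_of f) => mu mu_ptn.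
have [->|bn0] := eqVneq (tau_coef lam xi mu) 0; first by rewrite mul0r.
have [a [rest [muE le_N _]]] := tau_coef_Nprime mu_ptn bn0.
rewrite muE dschur_evE -?muE ?(leq_trans (ltnW mN)) // ifF ?mulr0 //.
by apply/eqP => mE; move: le_N; rewrite -mE leqNgt mN.
Qed.

Lemma tau2_coefE a r : tau2_coef lam xi (a :: nseq r 1%N) = U a r.
Proof. by rewrite /tau2_coef size_nseq eqxx /= /U /hook_family size_s0. Qed.

(** True hooks have N' = 0 and [invfact_det] equal to 1, so [tau_ev_hooks] applies with constant 1
    and yields the same bracket as [tau_evE]; this gives (ii). *)
Lemma tau2_evE i j :
  tau_ev (tau2_coef lam xi) 0 (@pt_x1x2 C) i j =
    (-1) ^+ j * (U i j + if j is j'.+1 then U i.+1 j' else 0).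
Proof.
have hookE a r : hook_family [::] a r = a :: nseq r 1%N
  by rewrite /hook_family subn0.
have U_supp a r : U a r != 0 -> (0 < a)%N.
  rewrite /U; case: ifP => [_ /tau_coef_supp1|_]; last by rewrite eqxx.
  exact: leq_trans lam1_gt0.
rewrite (@tau_ev_hooks C [::] _ 0 1) => [|mu mu_ptn bn0|a r _].
- by rewrite mul1r leq0n hookE tau2_coefE; case: j => // j;
  rewrite leq0n hookE tau2_coefE.
- left; case: mu mu_ptn bn0 => [|a rest] mu_ptn; first by rewrite eqxx.
  have [restE _|ne] := eqVneq rest (nseq (size rest) 1%N); last first.
    by rewrite /= (negPf ne) eqxx.
  move: (size rest) restE mu_ptn => r -> mu_ptn.
  exists a, r; split; [by []|by rewrite hookE|].
  move=> i' j'; rewrite dschur_evE // Nprime_cons sumn_nseq size_nseq mul1n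
    subnn.
  by rewrite eqxx invfact_det_hook fact0 mulr1.
rewrite hookE tau2_coefE => /U_supp a0; split.
  rewrite -hookE; apply: (@hook_family_partition a) => //.
  by rewrite /is_partition /= a0.
by rewrite /= sumn_nseq mul1n addn0.
Qed.

Lemma tau1_evE i : tau_ev (tau1_coef lam xi) 0 (@pt_x1 C) i 0 = U i k.
Proof.
have UE a : U a k = tau1_coef lam xi [:: a].
  by rewrite /U leqnn /hook_family size_s0 subnn cats0.
rewrite UE -[RHS](@sum_codes (i + 0 + 0) _ [:: i]); last first.
  move=> /tau_coef_supp1 /(leq_trans lam1_gt0) i0.
  by rewrite /is_partition /= i0 !addn0.
apply: eq_bigr => f _; move: (ptn_of f) => mu.
case: mu => [|a [|c mu]]; rewrite ?mul0r //; last by rewrite eqseq_cons andbF.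
rewrite eqseq_cons andbT.
have -> : dschur_ev (@pt_x1 C) 0 [:: a] = 'X ^+ a.
  rewrite /dschur_ev /= /schur det_mx11 mxE (_ : _ + _ = a%:Z);
    last by rewrite subr0 addr0.
  pose iota : {rmorphism C -> {poly {poly C}}} := polyC \o polyC.
  pose h (q : 'I_(nvar [:: a])) := pt_x1 C q.+1.
  (* The general recursion is used with x2 = y = 0, where the generating function is 1/(1 - x1
     z). *)
  have hE q : h q = iota (q.+1%:R^-1) * ('X ^+ q.+1 - 0 ^+ q.+1)
      + (if q == 0 :> nat then 0 else 0).
    by rewrite if_same addr0 expr0n subr0.
  suff main m : (m <= nvar [:: a])%N -> mmap iota h (pfun C (nvar [:: a]) m) =
    'X ^+ m.
    by apply: (main a); rewrite /nvar /=; lia.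
  elim: m => [|m IHm] mn.
    by rewrite /pfun big_ord1 expr0 coef1 invr1 scale1r; exact: rmorph1.
  rewrite (mmap_pfun_rec hE mn) IHm ?(ltnW mn) // -exprS.
  by rewrite /exp_coef expr0n mulr0 mul0r subr0 addr0.
rewrite coefXn; case: (i =P a) => [->|ne].
  by rewrite eqxx coef1 mulr1.
by rewrite coef0 mulr0 ifF //; apply/eqP => ?; apply: ne.
Qed.

Lemma U_eq0 a r : (a < lam1)%N || (r < k)%N -> U a r = 0.
Proof.
rewrite /U; have [kr|//] := leqP k r; rewrite orbF => a1.
by apply/eqP; apply: contraTT a1 => /tau_coef_supp1; rewrite -leqNgt.
Qed.

Lemma U_lam : U lam1 k = 1.
Proof. by rewrite /U leqnn /hook_family size_s0 subnn cats0 -lam_cons /tau_coef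
  eqxx. Qed.

Lemma tau2_factor : exists rest : fps C, rest 0%N 0%N = 0 /\
  forall i j, tau_ev (tau2_coef lam xi) 0 (@pt_x1x2 C) i j =
    fps_scale ((-1) ^+ k)
      (fps_mul (fps_mul (fps_mono C lam1.-1 k)
                        (fps_add (fps_mono C 1 0) (fps_scale (-1) (fps_mono C 0
                          1))))
               (fps_add (fps_mono C 0 0) rest)) i j.
Proof.
(* As tau_2 is the sum of U a r (-1)^r x1^(a-1) x2^r (x1 - x2), dividing by (-1)^k x1^(lam1-1) x2^k
   (x1 - x2) leaves [Z], with constant term [U lam1 k] = 1. *)
pose Z i j := (-1) ^+ j * U (i + lam1) (j + k).
exists (fun i j => Z i j - fps_mono C 0 0 i j); split.
  by rewrite /Z /fps_mono /= U_lam mulr1 subrr.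
move=> i j; rewrite tau2_evE /fps_scale fps_mul_mono_sub /fps_add.
rewrite ![fps_mono C 0 0 _ _ + _]addrC !subrK prednK ?lam1_gt0 //.
rewrite mulrBr mulrDr; congr (_ + _).
  case: ifP => [/andP[li kj]|lt].
    rewrite /Z !subnK // mulrA -exprD; congr (_ * _).
    by rewrite addnC subnK.
  by rewrite U_eq0 ?mulr0 //; lia.
case: j => [|j]; first by rewrite andbF !mulr0 oppr0.
case: ifP => [/andP[li kj]|lt].
  rewrite /Z subSS subnK // mulrA -exprD addnC subnK // exprS mulN1r mulNr.
  by congr (- (_ * U _ _)); have := lam1_gt0; lia.
by rewrite U_eq0 ?mulr0 ?oppr0 //; have := lam1_gt0; lia.
Qed.

Lemma tau2_leading : exists err : fps C,
  (forall i j, (j < size lam)%N -> err i j = 0) /\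
  forall i j, tau_ev (tau2_coef lam xi) 0 (@pt_x1x2 C) i j =
    fps_add
      (fps_scale ((-1) ^+ k)
         (fps_mul (fun a b => if b == 0%N then
                      tau_ev (tau1_coef lam xi) 0 (@pt_x1 C) a 0%N
                    else 0)
                  (fps_mono C 0 k))) err i j.
Proof.
set M := fps_scale _ _.
(* The error is the difference itself; only its vanishing for j < l needs an argument. *)
exists (fun i j => tau_ev (tau2_coef lam xi) 0 (@pt_x1x2 C) i j - M i j).
split=> [i j jl|i j]; last by rewrite /fps_add addrC subrK.
rewrite /M /fps_scale fps_mulC fps_mul_mono /= subn0 tau1_evE tau2_evE.
(* Since j <= k, the leg length j - 1 is below k and lies outside the support. *)
have -> : (if j is j'.+1 then U i.+1 j' else 0) = 0.
  by case: j jl => // j jl; apply: U_eq0; rewrite /k; lia.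
rewrite addr0; case: (ltngtP j k) => [jk|kj|->].
- by rewrite U_eq0 ?jk ?orbT // !mulr0 subrr.
- by move: jl kj; rewrite /k; lia.
by rewrite subnn /= subrr.
Qed.

End Tau.

Theorem theorem3p3 (R : realType) (lam : seq nat) (xi : seq nat -> R[i]) :
  is_partition lam -> (0 < size lam)%N ->
  let l := size lam in
  let tau := tau_coef lam xi in
  let tau2 := tau_ev (tau2_coef lam xi) 0 (@pt_x1x2 R[i]) in
  (* (i) *)
  (forall m : nat, (m < Nprime lam)%N ->
     forall i j, tau_ev tau m (@pt_x1x2 R[i]) i j = 0)
  (* (ii) *)
  /\ (forall i j, tau_ev tau (Nprime lam) (@pt_x1x2 R[i]) i j
                   = c_lam R[i] lam * tau2 i j)
  (* (iii) *)
  /\ (exists rest : fps R[i], rest 0%N 0%N = 0 /\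
        forall i j, tau2 i j =
          fps_scale ((-1) ^+ l.-1)
            (fps_mul (fps_mul (fps_mono R[i] (head 0%N lam).-1 l.-1)
                              (fps_add (fps_mono R[i] 1 0)
                                       (fps_scale (-1) (fps_mono R[i] 0 1))))
                     (fps_add (fps_mono R[i] 0 0) rest)) i j)
  (* (iv) *)
  /\ (exists err : fps R[i], (forall i j, (j < l)%N -> err i j = 0) /\
        forall i j, tau2 i j =
          fps_add
            (fps_scale ((-1) ^+ l.-1)
               (fps_mul (fun a b => if b == 0%N then
                            tau_ev (tau1_coef lam xi) 0 (@pt_x1 R[i]) a 0%N
                          else 0)
                        (fps_mono R[i] 0 l.-1)))
            err i j).
Proof.
move=> lam_ptn lam_gt0 l tau tau2; split; [|split; [|split]].
- by move=> m mN i j; apply: tau_ev_eq0.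
- by move=> i j; rewrite /tau2 tau_evE // tau2_evE.
- exact: tau2_factor.
- exact: tau2_leading.
Qed.
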